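(* Let $X$ be a Hadamard space with linear dual space $X^{\lozenge}$, let $p\in X$, and let $T:X\multimap X^{\lozenge}$ be a set-valued operator with $\mathrm{gra}(T)\ne\emptyset$. The following hold. (i) $\Phi^p_T=(\iota_{\mathrm{gra}(T)}+\pi_p)_p^{\lozenge}\circ r$. (ii) $(\Phi^p_T)_p^{\lozenge}\circ r\le\pi_p+\iota_{\mathrm{gra}(T)}$. (iii) If $T$ is monotone, then $\Phi^p_T\le(\Phi^p_T)_p^{\lozenge}\circ r\le\pi_p+\iota_{\mathrm{gra}(T)}$, with equality (throughout) at every point of $\mathrm{gra}(T)$. (iv) If $T$ is monotone and $\{\Phi^p_T\le\pi_p\}=\mathrm{gra}(T)$, then $\Phi^p_T=\big(\Phi^p_T+\iota_{\{\Phi^p_T\le\pi_p\}}\big)_p^{\lozenge}\circ r$. (v) Suppose $T$ is maximal monotone and $C:=\{\Phi^p_T=\pi_p\}=\{\Phi^p_T\le\pi_p\}=\mathrm{gra}(T)$. Then $\Phi^p_T=(\Phi^p_T+\iota_C)_p^{\lozenge}\circ r$.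
   Context: A Hadamard space is a (nonempty) complete $\mathrm{CAT}(0)$ space $(X,d)$. Quasilinearization: for $x,y,u,v\in X$, $\langle\overrightarrow{xy},\overrightarrow{uv}\rangle:=\frac12\big(d(x,v)^2+d(y,u)^2-d(x,u)^2-d(y,v)^2\big)$. Dual spaces: for $t\in\mathbb R$, $a,b\in X$, $[t\overrightarrow{ab}]$ is the class of $(t,a,b)\in\mathbb R\times X^2$ under the relation $(t,a,b)\sim(s,c,d)$ iff $t\langle\overrightarrow{ab},\overrightarrow{xy}\rangle=s\langle\overrightarrow{cd},\overrightarrow{xy}\rangle$ for all $x,y\in X$; it is identified with the function $\overrightarrow{xy}\mapsto t\langle\overrightarrow{ab},\overrightarrow{xy}\rangle$ on $X^2$. $X^*$ is the set of all such classes, and the linear dual $X^{\lozenge}$ is the real vector space of all finite linear combinations $\sum_i\alpha_i x_i^*$ ($\alpha_i\in\mathbb R$, $x_i^*\in X^*$), acting on $X^2$ by $\langle\sum_i\alpha_ix_i^*,\overrightarrow{xy}\rangle=\sum_i\alpha_i\langle x_i^*,\overrightarrow{xy}\rangle$ (elements with the same action are equal). Fix $p\in X$. $\pi_p(x,x^{\lozenge}):=\langle x^{\lozenge},\overrightarrow{px}\rangle$ on $X\times X^{\lozenge}$; $r(x,x^{\lozenge}):=(x^{\lozenge},x)$. The indicator $\iota_A$ equals $0$ on $A$ and $\infty$ off $A$. For $h:X\times X^{\lozenge}\to[-\infty,\infty]$, $\{h\le\pi_p\}$ and $\{h=\pi_p\}$ are the sets of $(x,x^{\lozenge})$ with $h(x,x^{\lozenge})\le\pi_p(x,x^{\lozenge})$,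 respectively $=$. The $p$-Fenchel conjugate $h_p^{\lozenge}:X^{\lozenge}\times X\to[-\infty,\infty]$ is $$h_p^{\lozenge}(x^{\lozenge},x)=\sup_{(y,y^{\lozenge})\in X\times X^{\lozenge}}\{\langle x^{\lozenge},\overrightarrow{py}\rangle+\langle y^{\lozenge},\overrightarrow{px}\rangle-h(y,y^{\lozenge})\}.$$ For a set-valued operator $T:X\multimap X^{\lozenge}$ (a map assigning to each $x\in X$ a possibly empty subset $T(x)\subseteq X^{\lozenge}$), $\mathrm{gra}(T)=\{(x,x^{\lozenge}):x^{\lozenge}\in T(x)\}$. $T$ is monotone if $\langle x^{\lozenge}-y^{\lozenge},\overrightarrow{yx}\rangle\ge0$ for all $(x,x^{\lozenge}),(y,y^{\lozenge})\in\mathrm{gra}(T)$; it is maximal monotone if it is monotone and no monotone operator has a graph properly containing $\mathrm{gra}(T)$. The $p$-Fitzpatrick transform of $T$ is $\Phi^p_T:X\times X^{\lozenge}\to[-\infty,\infty]$, $$\Phi^p_T(x,x^{\lozenge})=\sup_{(y,y^{\lozenge})\in\mathrm{gra}(T)}\{\langle x^{\lozenge},\overrightarrow{py}\rangle-\langle y^{\lozenge},\overrightarrow{xy}\rangle\}.$$ *)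

(* Defs.v *)
From HB Require Import structures.
From mathcomp Require Import all_boot all_order all_algebra.
From mathcomp Require Import all_classical all_reals all_analysis.

Set Implicit Arguments.
Unset Strict Implicit.
Unset Printing Implicit Defensive.

Import Order.TTheory GRing.Theory Num.Theory.

Local Open Scope classical_set_scope.
Local Open Scope ring_scope.

(* The norm that MathComp-Analysis puts on ['rV[R]_2] is the sup norm, hence
   this explicit Euclidean distance. *)
Definition eucl_dist (R : realType) (u v : 'rV[R]_2) : R :=
  Num.sqrt (\sum_(i < 2) (u 0 i - v 0 i) ^+ 2).

Definition on_segment (R : realType) (u v z : 'rV[R]_2) : Prop :=
  exists2 l : R, 0 <= l <= 1 & z = (1 - l) *: u + l *: v.

(* [c] restricted to [0, d(x, y)] is a geodesic from [x] to [y]. *)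
Definition geodesic (R : realType) (X : metricType R) (x y : X) (c : R -> X)
    : Prop :=
  [/\ c 0 = x, c (mdist x y) = y &
      forall s t, 0 <= s <= mdist x y -> 0 <= t <= mdist x y ->
        mdist (c s) (c t) = `|s - t|].

Definition geodesic_space (R : realType) (X : metricType R) : Prop :=
  forall x y : X, exists c, geodesic x y c.

(* The CAT(0) inequality. The geodesic triangle has vertices [v i] and sides
   [c i] from [v i] to [v (ordS i)], the index [ordS i] being i + 1 modulo 3;
   [w] is a comparison triangle in the Euclidean plane, and [a], [b] are the
   comparison points of [c i s] and [c j t]. *)
Definition cat0_inequality (R : realType) (X : metricType R) : Prop :=
  forall (v : 'I_3 -> X) (c : 'I_3 -> R -> X) (w : 'I_3 -> 'rV[R]_2),
    (forall i, geodesic (v i) (v (ordS i)) (c i)) ->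
    (forall i, eucl_dist (w i) (w (ordS i)) = mdist (v i) (v (ordS i))) ->
  forall (i j : 'I_3) (s t : R) (a b : 'rV[R]_2),
    0 <= s <= mdist (v i) (v (ordS i)) ->
    0 <= t <= mdist (v j) (v (ordS j)) ->
    on_segment (w i) (w (ordS i)) a -> eucl_dist (w i) a = s ->
    on_segment (w j) (w (ordS j)) b -> eucl_dist (w j) b = t ->
  mdist (c i s) (c j t) <= eucl_dist a b.

HB.mixin Record Metric_isCAT0 (R : realType) X & Metric R X := {
  cat0_nonempty : [set: X] !=set0;
  cat0_geodesic : geodesic_space X;
  cat0_comparison : cat0_inequality X
}.

#[short(type="hadamardType")]
HB.structure Definition Hadamard (R : realType) :=
  { X of Metric R X & Complete X & Metric_isCAT0 R X }.

Definition quasilin (R : realType) (X : metricType R) (x y u v : X) : R :=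
  2^-1 * (mdist x v ^+ 2 + mdist y u ^+ 2 - mdist x u ^+ 2 - mdist y v ^+ 2).

(* The class of (t, a, b), as a function of the pair (x, y); two triples are
   equivalent exactly when these functions are equal. *)
Definition dual_class (R : realType) (X : metricType R) (t : R) (a b : X)
    : X * X -> R :=
  fun xy => t * quasilin a b xy.1 xy.2.

Definition dual_space (R : realType) (X : metricType R) : set (X * X -> R) :=
  [set f | exists t a b, f = dual_class t a b].

Definition dual_span (R : realType) (X : metricType R) : set (X * X -> R) :=
  [set f | exists (n : nat) (alpha : 'I_n -> R) (g : 'I_n -> X * X -> R),
    (forall i, dual_space (g i)) /\
    f = (fun xy => \sum_(i < n) alpha i * g i xy)].

Definition in_dual_span (R : realType) (X : metricType R)
  : {pred (X * X -> R)} := fun f => `[< dual_span f >].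

Lemma in_dual_span_submod (R : realType) (X : metricType R) :
  submod_closed (@in_dual_span R X).
Proof.
split.
  by apply/asboolP; exists 0%N, (fun=> 0), (fun=> 0); split=> [[]//|];
     apply/funext => xy; rewrite big_ord0.
move=> k f h /asboolP [n [al [g [gP ->]]]] /asboolP [m [be [e [eP ->]]]].
apply/asboolP; exists (n + m)%N,
  (fun i => match fintype.split i with inl j => k * al j | inr j => be j end),
  (fun i => match fintype.split i with inl j => g j | inr j => e j end).
split=> [i|]; first by case: (fintype.split i).
apply/funext => xy; rewrite big_split_ord /=.
have El (i : 'I_n) : fintype.split (lshift m i) = inl i := unsplitK (inl i).
have Er (i : 'I_m) : fintype.split (rshift n i) = inr i := unsplitK (inr i).
under eq_bigr do rewrite El -mulrA.
under [X in _ = _ + X]eq_bigr do rewrite Er.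
by rewrite -mulr_sumr.
Qed.

HB.instance Definition _ (R : realType) (X : metricType R) :=
  GRing.isSubmodClosed.Build R (X * X -> R) (@in_dual_span R X)
    (@in_dual_span_submod R X).

Record linear_dual (R : realType) (X : metricType R) := LinearDual {
  linear_dual_fun : X * X -> R;
  linear_dualP : linear_dual_fun \in @in_dual_span R X
}.

HB.instance Definition _ (R : realType) (X : metricType R) :=
  [isSub for @linear_dual_fun R X].
HB.instance Definition _ (R : realType) (X : metricType R) :=
  [Choice of linear_dual X by <:].
HB.instance Definition _ (R : realType) (X : metricType R) :=
  [SubChoice_isSubLmodule of linear_dual X by <:].

(* The value of [xs] on the vector from [x] to [y] *)
Definition pairing (R : realType) (X : metricType R)
    (xs : linear_dual X) (x y : X) : R :=
  linear_dual_fun xs (x, y).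

Definition coupling (R : realType) (X : metricType R) (p : X)
    (z : X * linear_dual X) : \bar R :=
  (pairing z.2 p z.1)%:E.

Definition dual_flip (R : realType) (X : metricType R) (z : X * linear_dual X)
    : linear_dual X * X :=
  (z.2, z.1).

(* With [-oo + +oo = -oo] in [\bar R], a sum [h \+ indicator _ A] is the expected
   one when [h] never takes the value [-oo]; this holds for [coupling p], and for
   [fitzpatrick p T] below as soon as the graph of [T] is nonempty. *)
Definition indicator (R : realType) (S : Type) (A : set S) (z : S) : \bar R :=
  if z \in A then 0%E else +oo%E.

Definition le_coupling (R : realType) (X : metricType R) (p : X)
    (h : X * linear_dual X -> \bar R) : set (X * linear_dual X) :=
  [set z | (h z <= coupling p z)%E].

Definition eq_coupling (R : realType) (X : metricType R) (p : X)
    (h : X * linear_dual X -> \bar R) : set (X * linear_dual X) :=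
  [set z | h z = coupling p z].

Definition fenchel_conj (R : realType) (X : metricType R) (p : X)
    (h : X * linear_dual X -> \bar R) (z : linear_dual X * X) : \bar R :=
  ereal_sup [set ((pairing z.1 p w.1)%:E + (pairing w.2 p z.2)%:E - h w)%E
            | w in [set: X * linear_dual X]].

Definition graph_of (R : realType) (X : metricType R)
    (T : X -> set (linear_dual X)) : set (X * linear_dual X) :=
  [set z | T z.1 z.2].

Definition monotone_op (R : realType) (X : metricType R)
    (T : X -> set (linear_dual X)) : Prop :=
  forall z w, graph_of T z -> graph_of T w ->
    0 <= pairing (z.2 - w.2) w.1 z.1.

Definition maximal_monotone (R : realType) (X : metricType R)
    (T : X -> set (linear_dual X)) : Prop :=
  monotone_op T /\
  forall S : X -> set (linear_dual X), monotone_op S ->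
    ~ (graph_of T `<` graph_of S).

Definition fitzpatrick (R : realType) (X : metricType R) (p : X)
    (T : X -> set (linear_dual X)) (z : X * linear_dual X) : \bar R :=
  ereal_sup [set ((pairing z.2 p w.1)%:E - (pairing w.2 z.1 w.1)%:E)%E
            | w in graph_of T].

(* Main.v *)
(** Write F(w, z) = <z*, pw> + <w*, pz> - <w*, pw>. Elements of the linear dual
    are additive along concatenated vectors, so the Fitzpatrick transform is
    Phi(z) = sup of F(w, z) over w in gra T, and F is symmetric up to
    F(w, z) + <w*, pw> = F(z, w) + <z*, pz>. This yields (i) and (ii). When T
    is monotone, Phi = pi_p on gra T, so restricting the supremum defining the
    conjugate of Phi to gra T bounds it below by Phi; and in (iv), (v) the
    function being conjugated is the one in (i). *)
Require Import Defs.
From mathcomp Require Import all_boot all_order all_algebra.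
From mathcomp Require Import all_classical all_reals all_analysis.
From mathcomp Require Import ring lra.

Set Implicit Arguments.
Unset Strict Implicit.

Import Order.TTheory GRing.Theory Num.Theory.

Local Open Scope classical_set_scope.
Local Open Scope ereal_scope.

(** On a generator [dual_class t a b] the squared distances from [a] and [b] to the middle point [y]
    cancel; finite linear combinations inherit this. *)
Lemma pairing_chasles (R : realType) (X : metricType R) (xs : linear_dual X)
    (x y z : X) :
  (pairing xs x y + pairing xs y z = pairing xs x z)%R.
Proof.
case: xs => f fP; rewrite /pairing /=.
have /asboolP[n [al [g [gP ->]]]] := fP.
rewrite -big_split; apply: eq_bigr => i _ /=.
have [t [a [b ->]]] := gP i.
by rewrite /dual_class /quasilin /=; ring.
Qed.

Lemma pairingB (R : realType) (X : metricType R) (xs ys : linear_dual X)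
    (x y : X) :
  (pairing (xs - ys) x y = pairing xs x y - pairing ys x y)%R.
Proof. by []. Qed.

(** Off [A] both sums are [+oo]; excluding the value [-oo] matters there because
    [-oo + +oo = -oo]. *)
Lemma addl_indicator_eq (R : realType) (S : Type) (A : set S)
    (f g : S -> \bar R) :
  (forall z, A z -> f z = g z) -> (forall z, f z != -oo) ->
  (forall z, g z != -oo) ->
  f \+ indicator R A = g \+ indicator R A.
Proof.
move=> fg fN gN; apply/funext => z /=; rewrite /indicator.
case: ifPn => [/set_mem/fg ->//|_].
by rewrite !addey.
Qed.

Section Fitzpatrick.
Variables (R : realType) (X : metricType R) (p : X) (T : X -> set (linear_dual X)).
Implicit Types z w : X * linear_dual X.

Local Notation Phi := (fitzpatrick p T).

(** Splitting the vector from [p] to [w.1] at [z.1] turns a Fitzpatrick term into a conjugate term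
    of [coupling p]. *)
Lemma fitzpatrick_termE z w :
  (pairing z.2 p w.1)%:E - (pairing w.2 z.1 w.1)%:E =
  (pairing z.2 p w.1)%:E + (pairing w.2 p z.1)%:E - coupling p w.
Proof.
rewrite /coupling -!(EFinD, EFinB); congr _%:E.
by rewrite -(pairing_chasles w.2 p z.1 w.1); ring.
Qed.

Lemma fitzpatrick_ge z w : graph_of T w ->
  (pairing z.2 p w.1)%:E + (pairing w.2 p z.1)%:E - coupling p w <= Phi z.
Proof.
by move=> Tw; rewrite -fitzpatrick_termE; apply: ereal_sup_ubound; exists w.
Qed.

Lemma fitzpatrick_neqNy z : graph_of T !=set0 -> Phi z != -oo.
Proof.
by case=> w /(fitzpatrick_ge z); rewrite /coupling -!(EFinD, EFinB); case: (Phi z).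
Qed.

Lemma fenchel_conj_indicatorE :
  Phi = fenchel_conj p (indicator R (graph_of T) \+ coupling p)
          \o @dual_flip R X.
Proof.
apply/funext => z; apply/eqP; rewrite eq_le; apply/andP; split.
  apply: ge_ereal_sup => _ [w Tw <-]; rewrite fitzpatrick_termE.
  apply: ereal_sup_ubound; exists w => //=.
  by rewrite /indicator mem_set// add0e.
apply: ge_ereal_sup => _ [w _ <-] /=; rewrite /indicator.
case: ifPn => [/set_mem Tw|_]; first by rewrite add0e fitzpatrick_ge.
(* Off the graph the conjugated function is [+oo], so its term is [-oo]. *)
by rewrite leNye.
Qed.

Lemma fenchel_conj_fitzpatrick_le z :
  (fenchel_conj p Phi \o @dual_flip R X) z
    <= (coupling p \+ indicator R (graph_of T)) z.
Proof.
rewrite /= /indicator; case: ifPn => [/set_mem Tz|_]; last first.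
  by rewrite leey.
rewrite adde0; apply: ge_ereal_sup => _ [w _ <-] /=.
(* The roles are swapped: [z] is a competitor in the supremum [Phi w]. This bounds [Phi w] below by
   a real, and for finite [Phi w] the bound rearranges to the goal. *)
have := fitzpatrick_ge w Tz; rewrite /coupling -!(EFinD, EFinB).
case: (Phi w) => [r| |]//=; last by rewrite leNye.
by rewrite -!(EFinD, EFinB) !lee_fin; lra.
Qed.

Hypothesis Tmon : monotone_op T.

Lemma fitzpatrick_graph z : graph_of T z -> Phi z = coupling p z.
Proof.
move=> Tz; apply/eqP; rewrite eq_le; apply/andP; split.
  apply: ge_ereal_sup => _ [w Tw <-].
  (* After both vectors are split at [w.1], the term at [w] differs from [coupling p z] by exactly
     minus the monotonicity expression. *)
  have := Tmon Tz Tw; rewrite pairingB.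
  have := pairing_chasles z.2 p w.1 z.1; have := pairing_chasles w.2 p w.1 z.1.
  rewrite fitzpatrick_termE /coupling -!(EFinD, EFinB) lee_fin; lra.
(* The competitor [w = z] attains the value. *)
apply: le_trans (fitzpatrick_ge z Tz).
by rewrite /coupling -!(EFinD, EFinB) lee_fin addrK.
Qed.

Lemma fitzpatrick_le_fenchel_conj z :
  Phi z <= (fenchel_conj p Phi \o @dual_flip R X) z.
Proof.
apply: ge_ereal_sup => _ [w Tw <-]; rewrite fitzpatrick_termE.
by apply: ereal_sup_ubound; exists w => //=; rewrite fitzpatrick_graph.
Qed.

Lemma fenchel_conj_fitzpatrick_restr : graph_of T !=set0 ->
  Phi = fenchel_conj p (Phi \+ indicator R (graph_of T)) \o @dual_flip R X.
Proof.
move=> T0; rewrite (addl_indicator_eq (g := coupling p))//.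
- rewrite [LHS]fenchel_conj_indicatorE.
  by congr (fenchel_conj p _ \o _); apply/funext => z /=; rewrite addeC.
- exact: fitzpatrick_graph.
- by move=> z; exact: fitzpatrick_neqNy.
Qed.

End Fitzpatrick.

Theorem proposition5p11 (R : realType) (X : hadamardType R) (p : X)
    (T : X -> set (linear_dual X)) (graT_neq0 : graph_of T !=set0) :
  let Phi := fitzpatrick p T in
  [/\ Phi = fenchel_conj p (indicator R (graph_of T) \+ coupling p) \o @dual_flip R X,
      (forall z, (fenchel_conj p Phi \o @dual_flip R X) z
                 <= (coupling p \+ indicator R (graph_of T)) z),
      (monotone_op T ->
        (forall z,
          Phi z <= (fenchel_conj p Phi \o @dual_flip R X) z /\
          (fenchel_conj p Phi \o @dual_flip R X) z
            <= (coupling p \+ indicator R (graph_of T)) z) /\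
        (forall z, graph_of T z ->
          Phi z = (fenchel_conj p Phi \o @dual_flip R X) z /\
          (fenchel_conj p Phi \o @dual_flip R X) z
            = (coupling p \+ indicator R (graph_of T)) z)),
      (monotone_op T -> le_coupling p Phi = graph_of T ->
        Phi = fenchel_conj p (Phi \+ indicator R (le_coupling p Phi))
                \o @dual_flip R X) &
      (forall C : set (X * linear_dual X), maximal_monotone T ->
        C = eq_coupling p Phi -> eq_coupling p Phi = le_coupling p Phi ->
        le_coupling p Phi = graph_of T ->
        Phi = fenchel_conj p (Phi \+ indicator R C) \o @dual_flip R X)].
Proof.
move=> Phi; split.
- exact: fenchel_conj_indicatorE.
- exact: fenchel_conj_fitzpatrick_le.
- move=> Tmon; split=> z.
    by split; [exact: fitzpatrick_le_fenchel_conj|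
               exact: fenchel_conj_fitzpatrick_le].
  move=> Tz; have le1 := fitzpatrick_le_fenchel_conj p Tmon z.
  have le2 := fenchel_conj_fitzpatrick_le p T z.
  have E : Phi z = (coupling p \+ indicator R (graph_of T)) z.
    by rewrite /= /indicator mem_set// adde0; exact: fitzpatrick_graph.
  (* The outer members agree on the graph, so the sandwich collapses. *)
  rewrite -E in le2 *.
  by have -> : Phi z = (fenchel_conj p Phi \o @dual_flip R X) z
    by apply/eqP; rewrite eq_le le1.
- by move=> Tmon ->; exact: fenchel_conj_fitzpatrick_restr.
(* The chain of equalities turns [C] into the graph of [T]. *)
- by move=> C [Tmon _] -> -> ->; exact: fenchel_conj_fitzpatrick_restr.
Qed.
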